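(* Let $A$ be an abelian group of uncountable cardinal $\alpha$. Then $\mathcal{S}(A)$ contains a subset homeomorphic to $2^\alpha$. Accordingly, $\alpha$ is the least cardinality of a basis for the topology of $\mathcal{S}(A)$. In particular, if $A$ is uncountable, then $\mathcal{S}(A)$ is not metrizable.
   Context: For an abelian group $A$, $\mathcal{S}(A)$ denotes the set of all subgroups of $A$, with the topology induced by the product topology on the set $2^A$ of all subsets of $A$ (Chabauty topology). The space $2^\alpha=\{0,1\}^\alpha$ carries the product topology. *)

(* Defs.v *)
From HB Require Import structures.
From mathcomp Require Import all_boot all_order all_algebra.
From mathcomp Require Import all_classical all_reals all_analysis.

Set Implicit Arguments.
Unset Strict Implicit.
Unset Printing Implicit Defensive.

Import GRing.Theory.

Local Open Scope classical_set_scope.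
Local Open Scope card_scope.
Local Open Scope ring_scope.

(* The cube 2^I with the product topology, bool being discrete. For a set [A],
   a point of [cube A] is also a subset of [A], via its indicator function. *)
Definition cube (I : Type) : topologicalType := {ptws I -> bool}.

(* S(A) with the Chabauty topology: [set_type] carries the topology induced by
   the ambient space [cube A]. *)
Definition chabauty (A : zmodType) : topologicalType :=
  set_type [set S : cube A | GRing.zmod_closed (S : {pred A})].

Definition homeomorphic (S T : topologicalType) : Prop :=
  exists (f : S -> T) (g : T -> S),
    [/\ cancel f g, cancel g f, continuous f & continuous g].

Definition metrizable (R : realType) (T : topologicalType) : Prop :=
  exists M : metricType R, homeomorphic T M.

(* The cardinal is represented by an arbitrary type [I] of that cardinality. *)
Definition least_basis_card (I : Type) (T : topologicalType) : Prop :=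
  (exists B : set (set T), basis B /\ B #= [set: I]) /\
  (forall B : set (set T), basis B -> [set: I] #<= B).

(* Main.v *)
Require Import Defs.
From mathcomp Require Import all_boot all_order all_algebra.
From mathcomp Require Import all_classical all_reals all_analysis.

(**
  Choose by Zorn's lemma a maximal subset X of A that is independent, i.e. whose
  elements generate cyclic subgroups forming a direct sum.  Every nonzero element
  of A has a nonzero multiple in <X>, so A is torsion modulo <X> and <X> contains
  all elements of prime order; hence every element of A is obtained from 0 by
  finitely many operations "add or subtract an element of X" and "take a chosen
  p-th root".  If A is uncountable this forces |X| = |A|, because |seq T| = |T|
  for infinite T (from |T x T| = |T|).

  Independence gives <J> /\ <K> = <J /\ K> for J, K in X, so whether a belongs to
  <J> depends on finitely many elements of J only, and J |-> <J> embeds 2^X into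
  S(A).  For the same reason a neighbourhood of the trivial subgroup is contained
  in {S | x \notin S} for only finitely many x in X.  Hence a neighbourhood basis
  at the trivial subgroup has at least |X| elements when X is uncountable, which
  bounds the size of a basis from below and rules out metrizability; the
  cylinders form a basis of size |A|.
*)

Set Implicit Arguments.
Unset Strict Implicit.
Unset Printing Implicit Defensive.

Import Order.TTheory GRing.Theory Num.Theory.

Local Open Scope classical_set_scope.
Local Open Scope card_scope.

(** * Cardinal arithmetic *)

Lemma card_le_fun (T U : Type) (A : set T) (B : set U) (f : T -> U) :
  set_fun A B f -> set_inj A f -> A #<= B.
Proof.
elim/Ppointed: U => U in B f *.
  have -> : A = set0 by rewrite -subset0 => x; case: (no (f x)).
  by rewrite card_ge0.
by move=> fB finj; apply/pcard_leP/injfunPex; exists f.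
Qed.

Lemma card_le_funP (T U : Type) (A : set T) (B : set U) : A !=set0 ->
  A #<= B -> exists2 f : T -> U, set_fun A B f & set_inj A f.
Proof.
move=> [a Aa]; elim/Ppointed: U => U in B *.
  by move=> /card_leP[f]; case: (no (set_val (f (SigSub (mem_set Aa))))).
by move=> /pcard_leP/injfunPex.
Qed.

(** Witnesses are chosen in [option U], where [None] is the default, so [U] may be empty. *)
Lemma card_le_rel (T U : Type) (A : set T) (B : set U) (G : T -> U -> Prop) :
  (forall x, A x -> exists2 y, B y & G x y) ->
  (forall x x' y, A x -> A x' -> G x y -> G x' y -> x = x') ->
  A #<= B.
Proof.
move=> AG Ginj.
have [f fBG] : exists f : T -> option U,
    forall x, A x -> exists y, [/\ f x = Some y, B y & G x y].
  exists (fun x => if pselect (exists2 y, B y & G x y) is left e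
      then Some (s2val (cid2 e)) else None) => x /AG.
  case: pselect => // e _; exists (s2val (cid2 e)).
  by split=> //; [exact: (s2valP (cid2 e))|exact: (s2valP' (cid2 e))].
have : A #<= some @` B.
  apply: (@card_le_fun _ _ _ _ f) => [x /fBG[y [-> By _]]|]; first by exists y.
  move=> x x' /set_mem Ax /set_mem Ax'; have [y [-> By Gxy]] := fBG x Ax.
  have [y' [-> By' Gxy'] [yy']] := fBG x' Ax'.
  by apply: (Ginj _ _ y) => //; rewrite yy'.
by rewrite (card_le_eqr card_some).
Qed.

(** Zorn's lemma on graphs of partial injections from [A] to [B]: a maximal graph exhausts [A] or
    [B], since otherwise an unmatched pair could be added. *)
Lemma card_le_total (T U : Type) (A : set T) (B : set U) :
  A #<= B \/ B #<= A.
Proof.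
pose P (G : set (T * U)) :=
  G `<=` A `*` B /\ forall p q, G p -> G q -> (p.1 = q.1 <-> p.2 = q.2).
have [F FP Ftot|G [[GAB Ginj] Gmax]] := @Zorn_bigcup _ P.
  split=> [p [X FX Xp]|p q [X FX Xp] [Y FY Yq]]; first exact: (FP X FX).1.
  have [/(_ _ Xp) Yp|/(_ _ Yq) Xq] := Ftot _ _ FX FY.
  - exact: (FP Y FY).2.
  - exact: (FP X FX).2.
case: (EM (exists2 x, A x & forall y, ~ G (x, y))) => [[x Ax nGx]|nA]; last first.
  left; apply: (@card_le_rel _ _ _ _ (fun x y => G (x, y))).
    move=> x Ax; absurd_not => nG; apply: nA; exists x => // y Gxy.
    by apply: (nG y) => //; case: (GAB _ Gxy).
  by move=> x x' y _ _ Gx Gx'; apply/(Ginj _ _ Gx Gx').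
case: (EM (exists2 y, B y & forall x, ~ G (x, y))) => [[y By nGy]|nB]; last first.
  right; apply: (@card_le_rel _ _ _ _ (fun y x => G (x, y))).
    move=> y By; absurd_not => nG; apply: nB; exists y => // x' Gxy.
    by apply: (nG x') => //; case: (GAB _ Gxy).
  by move=> y y' x' _ _ Gx Gx'; apply/(Ginj _ _ Gx Gx').
have [] := Gmax (G `|` [set (x, y)]).
  by split=> [? ?|/(_ (x, y))]; [left|apply/not_implyP; split=> //; right].
split=> [p [/GAB//|->]//|p q].
move=> [Gp|->] [Gq|->] //=; first exact: Ginj.
- by case: p Gp => a b Gab /=; split=> e; [case: (nGx b)|case: (nGy a)]; rewrite -e.
- by case: q Gq => a b Gab /=; split=> e; [case: (nGx b)|case: (nGy a)]; rewrite e.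
Qed.

Lemma set_inj_cancel (T U : Type) (A : set T) (f : T -> U) (a : T) :
  set_inj A f -> exists g : U -> T, forall x, A x -> g (f x) = x.
Proof.
move=> finj.
exists (fun y => if pselect (exists2 x, A x & f x = y) is left e
  then s2val (cid2 e) else a) => x Ax.
case: pselect => [e|[]]; last by exists x.
apply: finj; rewrite ?inE//; first exact: (s2valP (cid2 e)).
exact: (s2valP' (cid2 e)).
Qed.

(** Zorn's lemma on infinite subsets [Y] with an injective pairing [Y * Y -> Y], ordered by
    extension. At a maximal [Y], either the complement embeds in [Y], and then so does [T], or [Y]
    embeds in its complement, and then the pairing extends to a larger set. *)
Lemma infinite_card_prod (T : Type) :
  infinite_set [set: T] -> [set: T * T] #<= [set: T].
Proof.
move=> /infiniteP /card_le_funP[|e0 _ e0inj]; first by exists 0%N.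
pose good (p : set T * (T -> T -> T)) := [/\ infinite_set p.1,
  forall x y, p.1 x -> p.1 y -> p.1 (p.2 x y) &
  forall x y x' y', p.1 x -> p.1 y -> p.1 x' -> p.1 y' ->
    p.2 x y = p.2 x' y' -> x = x' /\ y = y'].
(* Only a preorder: the values of a pairing outside its set are arbitrary. *)
pose R (p q : {p | good p}) := `[< (sval p).1 `<=` (sval q).1 /\
  forall x y, (sval p).1 x -> (sval p).1 y ->
    (sval p).2 x y = (sval q).2 x y >].
have good0 : exists p, good p.
  have [k ek] := set_inj_cancel 0%N e0inj.
  exists (range e0, fun x y => e0 (pickle (k x, k y))); split=> /=.
  - by apply/infiniteP; apply: (@card_le_fun _ _ _ _ e0) => // n _; exists n.
  - by move=> x y _ _; eexists.
  - move=> _ _ _ _ [m _ <-] [n _ <-] [m' _ <-] [n' _ <-] /(congr1 k).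
    by rewrite !ek// => /(pcan_inj (@pickleK _)) [-> ->].
have Rrefl p : R p p by apply/asboolP; split.
have [p0 gp0] := good0.
have [||A Atot|[[Y f] goodY] Ymax] := @ZL_preorder _ (exist _ p0 gp0) R.
- by [].
- move=> q p r /asboolP[pq pqE] /asboolP[qr qrE]; apply/asboolP; split.
    by move=> x /pq/qr.
  by move=> x y px py; rewrite pqE// qrE//; exact: pq.
- have [[q Aq]|A0] := EM (A !=set0); last first.
    by exists (exist _ p0 gp0) => s As; case: A0; exists s.
  pose Z := [set x | exists2 p, A p & (sval p).1 x].
  (* The union of the pairings along the chain; totality of the chain makes it independent of the
     chosen member. *)
  pose h x y :=
    if pselect (exists2 p, A p & (sval p).1 x /\ (sval p).1 y) is left e
    then (sval (s2val (cid2 e))).2 x y else x.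
  have hE p x y : A p -> (sval p).1 x -> (sval p).1 y -> h x y = (sval p).2 x y.
    rewrite /h => Ap px py; case: pselect => [e|[]]; last by exists p.
    have [ep [ex ey]] := (s2valP (cid2 e), s2valP' (cid2 e)).
    by have [/asboolP[_ ->]|/asboolP[_ ->]] := Atot _ _ ep Ap.
  have Z2 x y : Z x -> Z y -> exists2 p, A p & (sval p).1 x /\ (sval p).1 y.
    move=> [p Ap px] [p' Ap' py].
    have [/asboolP[pp' _]|/asboolP[pp' _]] := Atot _ _ Ap Ap'.
      by exists p' => //; split=> //; exact: pp'.
    by exists p => //; split=> //; exact: pp'.
  have gZ : good (Z, h).
    split=> /=.
    - have [qi _ _] := svalP q; apply: sub_infinite_set qi => x qx; by exists q.
    - move=> x y Zx Zy; have [p Ap [px py]] := Z2 _ _ Zx Zy.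
      by rewrite (hE p)//; exists p => //; have [_ + _] := svalP p; apply.
    - move=> x y x' y' Zx Zy Zx' Zy'.
      have [p Ap [px py]] := Z2 _ _ Zx Zy.
      have [p' Ap' [px' py']] := Z2 _ _ Zx' Zy'.
      rewrite (hE p)// (hE p')//.
      have [/asboolP[pp' E]|/asboolP[pp' E]] := Atot _ _ Ap Ap'.
        by rewrite E//; have [_ _ ] := svalP p'; apply=> //; exact: pp'.
      by rewrite E//; have [_ _ ] := svalP p; apply=> //; exact: pp'.
  exists (exist _ _ gZ) => p Ap; apply/asboolP; split=> [x px|x y px py] /=.
    by exists p.
  by rewrite (hE p).
have [/= Yinf fY finj] := goodY.
have /infiniteP/card_le_funP[|e eY einj] := Yinf; first by exists 0%N.
have {}eY n : Y (e n) by exact: eY.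
have {}einj m n : e m = e n -> m = n by move/einj; apply; rewrite inE.
have [ZY|YZ] := card_le_total (~` Y) Y.
  have [g gY ginj] : exists2 g : T -> T, set_fun (~` Y) Y g & set_inj (~` Y) g.
    have [->|/set0P/card_le_funP/(_ ZY)//] := eqVneq (~` Y) set0.
    by exists id => // x y; rewrite inE.
  (* The tags [e 0] and [e 1] keep the images of [Y] and of its complement apart. *)
  pose v x := if pselect (Y x) then f (e 0) x else f (e 1) (g x).
  have vY x : Y (v x) by rewrite /v; case: pselect => Yx; apply: (fY) => //; exact: gY.
  have vinj x y : v x = v y -> x = y.
    rewrite /v; case: pselect => Yx; case: pselect => Yy /= /finj [] //;
      try exact: gY; try by move=> /einj.
    by move=> _ /ginj; apply; rewrite inE.
  apply: (@card_le_fun _ _ _ _ (fun p => f (v p.1) (v p.2))) => //.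
  by move=> [x y] [x' y'] _ _ /= /finj[]// /vinj -> /vinj ->.
have [|g gY ginj] := card_le_funP _ YZ; first by exists (e 0).
have [k gk] := set_inj_cancel (e 0) ginj.
(* f' sends new pairs into g @` Y; pickle (c x, c y) records which of the two
   coordinates are new, which k alone forgets. *)
pose Y' := Y `|` g @` Y.
pose u x := if pselect (Y x) then x else k x.
have uY x : Y' x -> Y (u x).
  by rewrite /u; case: pselect => //= nYx [//|[y Yy <-]]; rewrite gk.
pose c x := if pselect (Y x) then 0%N else 1%N.
have uinj x y : Y' x -> Y' y -> u x = u y -> c x = c y -> x = y.
  rewrite /u /c; case: pselect => Yx; case: pselect => Yy //= [//|[x' Yx' <-]].
  by move=> [//|[y' Yy' <-]]; rewrite !gk// => ->.
pose f' x y := if pselect (Y x /\ Y y) then f x y else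
  g (f (e (pickle (c x, c y))) (f (u x) (u y))).
have goodY' : good (Y', f').
  split=> /=.
  - by apply: sub_infinite_set Yinf; left.
  - move=> x y Yx Yy; rewrite /f'; case: pselect => [[? ?]|?] /=.
      by left; exact: fY.
    right; exists (f (e (pickle (c x, c y))) (f (u x) (u y))) => //.
    by apply: (fY) => //; apply: (fY); exact: uY.
  - move=> x y x' y' Yx Yy Yx' Yy'; rewrite /f'.
    have ffY a b : Y' a -> Y' b -> Y (f (e (pickle (c a, c b))) (f (u a) (u b))).
      by move=> Ya Yb; apply: (fY) => //; apply: (fY); exact: uY.
    case: pselect => [[Y1 Y2]|?]; case: pselect => [[Y3 Y4]|?] //=.
    + by move=> /finj; apply.
    + by move=> E; have := gY _ (ffY _ _ Yx' Yy'); rewrite -E => -[]; exact: fY.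
    + by move=> E; have := gY _ (ffY _ _ Yx Yy); rewrite E => -[]; exact: fY.
    + move=> /ginj; rewrite !inE => /(_ (ffY _ _ Yx Yy) (ffY _ _ Yx' Yy')).
      move=> /finj[]//; try by apply: (fY); exact: uY.
      move=> /einj/(pcan_inj (@pickleK _))[cx cy] /finj[]; try exact: uY.
      by move=> ux uy; split; exact: uinj.
have /asboolP[/= Y'Y _] : R (exist _ _ goodY') (exist _ _ goodY).
  apply: Ymax; apply/asboolP; split=> /= [x Yx|x y Yx Yy]; first by left.
  by rewrite /f'; case: pselect => [//|[]].
by case: (gY _ (eY 0%N)); apply: Y'Y; right; exists (e 0).
Qed.

Lemma card_leT_inj (T U : Type) (f : T -> U) :
  injective f -> [set: T] #<= [set: U].
Proof. by move=> finj; apply: (@card_le_fun _ _ _ _ f) => // x y _ _ /finj. Qed.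

Lemma card_leT_injP (T U : Type) (x : T) :
  [set: T] #<= [set: U] -> exists f : T -> U, injective f.
Proof.
move=> /card_le_funP[|f _ finj]; first by exists x.
by exists f => y z /finj; apply; rewrite inE.
Qed.

Lemma infinite_card_seq (T : Type) :
  infinite_set [set: T] -> [set: seq T] #<= [set: T].
Proof.
move=> Tinf; have [e einj] := card_leT_injP 0%N ((infiniteP _).1 Tinf).
have [p pinj] := card_leT_injP (e 0%N, e 0%N) (infinite_card_prod Tinf).
(* The length is recorded beside the code, because the code [e 0] of the empty sequence may also
   code a nonempty one. *)
pose code := foldr (fun x y => p (x, y)) (e 0%N).
apply: (@card_leT_inj _ _ (fun s => p (e (size s), code s))) => s t /= /pinj[/einj].
elim: s t => [|x s IHs] [|y t] //= [/IHs st] /pinj[-> /st ->//].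
Qed.

Lemma infinite_card_prod_nat (T : Type) :
  infinite_set [set: T] -> [set: T * nat] #<= [set: T].
Proof.
move=> Tinf; have [e einj] := card_leT_injP 0%N ((infiniteP _).1 Tinf).
have [p pinj] := card_leT_injP (e 0%N, e 0%N) (infinite_card_prod Tinf).
apply: (@card_leT_inj _ _ (fun x => p (x.1, e x.2))).
by move=> [x m] [y n] /= /pinj[-> /einj ->].
Qed.

Lemma infinite_card_seq_nat (T : Type) :
  infinite_set [set: T] -> [set: seq (T * nat)] #<= [set: T].
Proof.
move=> Tinf; apply: card_le_trans (infinite_card_seq Tinf).
have [x _] := infinite_setN0 Tinf.
have [p pinj] := card_leT_injP (x, 0%N) (infinite_card_prod_nat Tinf).
exact: card_leT_inj (inj_map pinj).
Qed.

(** [B] is infinite, since otherwise [A] would be a finite union of countable fibres. Numbering each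
    fibre then embeds [A] into [B * nat], which is no larger than [B]. *)
Lemma card_le_fibers (T U : Type) (A : set T) (B : set U) (G : T -> U -> Prop) :
  ~ countable A -> (forall x, A x -> exists2 y, B y & G x y) ->
  (forall y, B y -> countable [set x | A x /\ G x y]) -> A #<= B.
Proof.
move=> Aunc AG Gc.
have Binf : infinite_set B.
  move=> /finite_set_countable Bc; apply: Aunc.
  apply: sub_countable (bigcup_countable Bc Gc); apply: subset_card_le => x Ax.
  by have [y By Gxy] := AG x Ax; exists y.
have /choice[h hinj] : forall y, exists f : T -> nat,
    B y -> set_inj [set x | A x /\ G x y] f.
  move=> y; have [By|nBy] := EM (B y); last by exists (fun=> 0%N).
  by have /countable_injP[f finj] := Gc y By; exists f.
apply: card_le_trans (_ : [set: B * nat] #<= B); last first.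
  rewrite -(card_le_eqr (card_setT B)); apply: infinite_card_prod_nat.
  by rewrite (eq_finite_set (card_setT B)).
apply: (@card_le_rel _ _ _ _ (fun x p => G x (val p.1) /\ h (val p.1) x = p.2)).
  by move=> x /[dup] Ax /AG[y By Gxy]; exists (SigSub (mem_set By), h y x).
move=> x x' [y n] Ax Ax' /= [Gx <-] [Gx' /esym].
by move=> /(hinj _ (set_valP y)); apply; rewrite inE.
Qed.

(** * Independent subsets of an abelian group *)

Local Open Scope ring_scope.

Inductive gen (A : zmodType) (X : set A) : set A :=
| gen0 : gen X 0
| gen_in x : X x -> gen X x
| genB x y : gen X x -> gen X y -> gen X (x - y).

(** The subgroups generated by [x] and by the rest of [X] meet trivially. It is the multiple that
    must vanish, not the coefficient, so torsion elements are allowed. *)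
Definition independent (A : zmodType) (X : set A) :=
  forall x, X x ->
    x != 0 /\ forall n : int, gen (X `\ x) (x *~ n) -> x *~ n = 0.

(** The subgroup generated by [X] meets every nonzero cyclic subgroup nontrivially. *)
Definition essential (A : zmodType) (X : set A) :=
  forall a, a != 0 -> exists2 n : int, a *~ n != 0 & gen X (a *~ n).

Section Gen.
Variable A : zmodType.
Implicit Types (X J K : set A) (a b x y : A).

Lemma genN X a : gen X a -> gen X (- a).
Proof. by rewrite -(sub0r a); apply: genB; exact: gen0. Qed.

Lemma genD X a b : gen X a -> gen X b -> gen X (a + b).
Proof. by move=> Xa /genN; rewrite -{2}(opprK b); exact: genB. Qed.

Lemma genMn X a n : gen X a -> gen X (a *+ n).
Proof.
by move=> Xa; elim: n => [|n IHn]; [exact: gen0|rewrite mulrS; exact: genD].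
Qed.

Lemma genMz X a (n : int) : gen X a -> gen X (a *~ n).
Proof. by move=> Xa; case: n => n; [|apply: genN]; exact: genMn. Qed.

Lemma genS J K : J `<=` K -> gen J `<=` gen K.
Proof.
move=> JK a; elim=> [|x Jx|x y _ Kx _ Ky]; first exact: gen0.
- exact/gen_in/JK.
- exact: genB.
Qed.

Lemma gen_set0 a : gen set0 a -> a = 0.
Proof. by elim=> // x y _ -> _ ->; rewrite subr0. Qed.

Lemma gen_zmod_closed X : zmod_closed (fun a => `[< gen X a >]).
Proof.
split=> [|a b /asboolP Xa /asboolP Xb]; apply/asboolP; first exact: gen0.
exact: genB.
Qed.

Lemma gen_setD1 x K a : gen K a -> exists n : int, gen (K `\ x) (a - x *~ n).
Proof.
elim=> [|y Ky|y z _ [m Km] _ [n Kn]].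
- by exists 0; rewrite mulr0z subr0; exact: gen0.
- have [->|yx] := eqVneq y x; first by exists 1; rewrite mulr1z subrr; exact: gen0.
  by exists 0; rewrite mulr0z subr0; apply: gen_in; split=> //; exact/eqP.
- exists (m - n); rewrite mulrzBr.
  have -> : y - z - (x *~ m - x *~ n) = (y - x *~ m) - (z - x *~ n).
    by rewrite !opprB addrACA [RHS]addrACA [- z + _]addrC.
  exact: genB.
Qed.

Lemma gen_finite X a : gen X a ->
  exists2 s : seq A, {subset s <= X} & gen [set` s] a.
Proof.
elim=> [|x Xx|x y _ [s sX gx] _ [t tX gy]]; first by exists [::]; last exact: gen0.
- exists [:: x]; last by apply: gen_in; rewrite /= inE.
  by move=> y; rewrite inE => /eqP ->; exact/mem_set.
- exists (s ++ t); first by move=> z; rewrite mem_cat => /orP[/sX|/tX].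
  apply: genB; [apply: genS gx|apply: genS gy] => z /= zs;
    by rewrite mem_cat zs ?orbT.
Qed.

(* Writing a = n x + z with z in <K \ x>, the multiple n x lies in
   <J> + <K \ x>, hence in <X \ x>, and vanishes by independence. *)
Lemma independent_gen_setD1 X J K x a : independent X -> J `<=` X -> K `<=` X ->
  ~ J x -> gen J a -> gen K a -> gen (K `\ x) a.
Proof.
move=> indX JX KX nJx Ja Ka.
have [Kx|nKx] := EM (K x); last first.
  by apply: genS Ka => y Ky; split=> // yx; apply: nKx; rewrite -yx.
have [_ indx] := indX _ (KX _ Kx); have [n Kn] := gen_setD1 x Ka.
suff xn0 : x *~ n = 0 by rewrite xn0 subr0 in Kn.
apply: indx; rewrite -(subKr a (x *~ n)); apply: genB.
  by apply: genS Ja => y Jy; split; [exact: JX|move=> yx; apply: nJx; rewrite -yx].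
by apply: genS Kn => y [/KX].
Qed.

(** Start from a finite part [s] of [K] that generates [a] and discard its elements outside [J] one
    at a time. *)
Lemma independent_gen_setI X J K a : independent X -> J `<=` X -> K `<=` X ->
  gen J a -> gen K a -> gen (J `&` K) a.
Proof.
move=> indX JX KX Ja /gen_finite[s sK sa].
(* [t] lists the elements already treated; the case [t = s] is the claim. *)
suff /(_ s) : forall t : seq A, gen [set y | y \in s /\ (y \notin t \/ J y)] a.
  by apply: genS => y [ys [|Jy]]; [rewrite ys|split=> //; exact/set_mem/sK].
elim=> [|x t IHt]; first by apply: genS sa => y ys; split=> //; left.
have [Jx|nJx] := EM (J x).
  apply: genS IHt => y [ys yt]; split=> //.
  have [->|yx] := eqVneq y x; first by right.
  by case: yt => yt; [left; rewrite inE negb_or yx|right].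
have /(independent_gen_setD1 indX JX) :
    [set y | y \in s /\ (y \notin t \/ J y)] `<=` X.
  by move=> y [/sK/set_mem/KX].
move=> /(_ _ _ nJx Ja IHt); apply: genS => y [[ys yt] /eqP yx]; split=> //.
by case: yt => yt; [left; rewrite inE negb_or yx|right].
Qed.

Lemma independent_gen_inj X J x : independent X -> J `<=` X -> X x ->
  gen J x -> J x.
Proof.
move=> indX JX Xx Jx; absurd_not => nJx; have [/eqP + _] := indX _ Xx; apply.
suff : gen set0 x by exact: gen_set0.
have : gen (J `&` [set x]) x.
  by apply: (independent_gen_setI indX) => // [_ ->//|]; exact: gen_in.
by apply: genS => y [Jy yx]; apply: nJx; rewrite -yx.
Qed.

Lemma independent_gen1_inj X x y a : independent X -> X x -> X y -> a != 0 ->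
  gen [set x] a -> gen [set y] a -> x = y.
Proof.
move=> indX Xx Xy a0 xa ya; absurd_not => xy; move/eqP: a0; apply.
apply: gen_set0.
have : gen ([set x] `&` [set y]) a.
  by apply: (independent_gen_setI indX) => // _ ->.
by apply: genS => _ [-> /eqP]; rewrite (negPf xy).
Qed.

Lemma maximal_independent : exists2 X : set A, independent X & essential X.
Proof.
have [F Find Ftot|X [indX Xmax]] := @Zorn_bigcup _ (@independent A).
  move=> x [X FX Xx]; split=> [|n Fn]; first by have [] := Find X FX x Xx.
  (* A relation uses finitely many generators, so a single member of the chain contains them all. *)
  have [Y [FY XY Yn]] : exists Y, [/\ F Y, X `<=` Y & gen (Y `\ x) (x *~ n)].
    elim: Fn => [|y [[Y FY Yy] yx]|y z _ [Y [FY XY gy]] _ [Z [FZ XZ gz]]].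
    - by exists X; split=> //; exact: gen0.
    - have [XY|YX] := Ftot _ _ FX FY.
        by exists Y; split=> //; exact: gen_in.
      by exists X; split=> //; apply: gen_in; split=> //; exact: YX.
    - have [YZ|ZY] := Ftot _ _ FY FZ.
        exists Z; split=> //; apply: genB gz; apply: genS gy => t [/YZ Zt tx].
        by split.
      exists Y; split=> //; apply: genB gy _; apply: genS gz => t [/ZY Zt tx].
      by split.
  by have [_] := Find Y FY x (XY _ Xx); apply.
exists X => // a a0; apply: contrapT => nX.
have {}nX (n : int) : gen X (a *~ n) -> a *~ n = 0.
  by move=> Xan; apply: contrapT => /eqP an0; apply: nX; exists n.
have nXa : ~ X a.
  move=> Xa; move/eqP: a0; apply.
  by rewrite -[a]mulr1z; apply: nX; exact: gen_in.
(* If no nonzero multiple of [a] lies in <X>, then adding [a] keeps [X] independent: in any relation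
   the multiple of [a] lies in <X>, hence vanishes. *)
have [] := Xmax (X `|` [set a]).
  by split=> [? ?|/(_ a)]; [left|apply/not_implyP; split=> //; right].
move=> x [Xx|->]; last first.
  by split=> // n an; apply: nX; apply: genS an => y [[]].
have [x0 xind] := indX _ Xx; split=> // n xn.
have [m am] := gen_setD1 a xn.
have {am}xm : gen (X `\ x) (x *~ n - a *~ m).
  by apply: genS am => y [[[]]].
have am : a *~ m = 0.
  apply: nX; rewrite -(subKr (x *~ n) (a *~ m)); apply: genB.
    by apply/genMz/gen_in.
  by apply: genS xm => y [].
by apply: xind; rewrite am subr0 in xm.
Qed.

End Gen.

(** * Coding group elements by words *)

Section Words.
Variables (A : zmodType) (X : set A).

(** The root depends on [n] and [c] alone, so a word need not record which root is taken; [c] is the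
    default when there is none. *)
Definition nroot (n : nat) (c : A) : A :=
  if pselect (exists a, a *+ n = c) is left e then sval (cid e) else c.

Lemma nrootK n a : nroot n (a *+ n) *+ n = a *+ n.
Proof.
rewrite /nroot; case: pselect => [e|[]]; first exact: (svalP (cid e)).
by exists a.
Qed.

(** Labels 0 and 1 are free to mean addition and subtraction because only prime roots are taken. *)
Fixpoint word_eval (w : seq (X * nat)) : A :=
  match w with
  | [::] => 0
  | (x, 0%N) :: w' => word_eval w' + val x
  | (x, 1%N) :: w' => word_eval w' - val x
  | (_, n) :: w' => nroot n (word_eval w')
  end.

Lemma word_eval_gen a b : range word_eval a -> gen X b ->
  range word_eval (a + b).
Proof.
(* Both signs are carried along so that the induction passes through the subtraction in [genB]. *)
move=> Da Xb; suff : forall a', range word_eval a' ->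
  range word_eval (a' + b) /\ range word_eval (a' - b) by move=> /(_ _ Da)[].
elim: Xb => {a b Da} [|x Xx|x y _ IHx _ IHy] a Da.
- by rewrite subr0 addr0.
- have [w _ <-] := Da; pose sx : X := SigSub (mem_set Xx).
  by split; [exists ((sx, 0%N) :: w)|exists ((sx, 1%N) :: w)].
- have [Dx DNx] := IHx _ Da; split; first by rewrite addrA; exact: (IHy _ Dx).2.
  by rewrite opprB addrCA addrC; exact: (IHy _ DNx).1.
Qed.

Hypothesis essX : essential X.

(** Some nonzero multiple [b *+ m] lies in <X>; then [m] is prime to [p], and a Bezout relation
    recovers [b] from it. *)
Lemma essential_torsion p b : prime p -> b *+ p = 0 -> gen X b.
Proof.
move=> pp pb; have [->|b0] := eqVneq b 0; first exact: gen0.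
have [m bm0 Xbm] : exists2 m : nat, b *+ m != 0 & gen X (b *+ m).
  have [[m|m] bn0 Xbn] := essX b0; first by exists m.
  exists m.+1; first by move: bn0; rewrite oppr_eq0.
  by rewrite -(opprK (b *+ m.+1)); exact: genN.
have pm : coprime m p.
  rewrite coprime_sym prime_coprime//; apply: contra bm0 => /dvdnP[k ->].
  by rewrite mulnC mulrnA pb mul0rn.
have m0 : (0 < m)%N by move: bm0; case: (m) => //; rewrite mulr0n eqxx.
case: (egcdnP p m0) => u v uv _.
have -> : b = b *+ m *+ u.
  by rewrite -mulrnA mulnC uv (eqP pm) mulrnDr mulnC mulrnA pb mul0rn add0r.
exact: genMn.
Qed.

Hypothesis X0 : X !=set0.

(* The chosen p-th root of p a differs from a by an element of order dividing
   the prime p, which lies in <X>. *)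
Lemma word_eval_torsion m a : (0 < m)%N -> gen X (a *+ m) -> range word_eval a.
Proof.
elim/ltn_ind: m a => m IHm a m0 Xam.
have [m1|m1] := leqP m 1.
  have m1E : m = 1%N by apply/eqP; rewrite eqn_leq m1.
  rewrite m1E mulr1n in Xam.
  by rewrite -(add0r a); apply: word_eval_gen => //; exists [::].
have pp := pdiv_prime m1; set p := pdiv m in pp.
have mE : m = (p * (m %/ p))%N by rewrite mulnC divnK// pdiv_dvd.
(* Induction applies to [a *+ p], whose multiple by the smaller number [m %/ p] is [a *+ m]. *)
have [w _ wE] : range word_eval (a *+ p).
  apply: (IHm (m %/ p)%N).
  - by rewrite ltn_Pdiv// prime_gt1.
  - by rewrite divn_gt0 ?prime_gt0// pdiv_leq.
  - by rewrite -mulrnA -mE.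
have Dr : range word_eval (nroot p (a *+ p)).
  (* Any element of [X] can accompany the label [p], which is at least 2 and so denotes a root. *)
  have [x Xx] := X0; exists ((SigSub (mem_set Xx), p) :: w) => //=.
  by rewrite wE; case: (p) pp => [|[]].
rewrite -(subrK (nroot p (a *+ p)) a) addrC; apply: word_eval_gen => //.
by apply: (essential_torsion pp); rewrite mulrnBl nrootK subrr.
Qed.

Lemma word_eval_surj a : range word_eval a.
Proof.
have [->|a0] := eqVneq a 0; first by exists [::].
have [[m|m] an0 Xan] := essX a0.
  by apply: word_eval_torsion Xan; case: (m) an0 => //; rewrite mulr0z eqxx.
apply: (@word_eval_torsion m.+1) => //.
by rewrite -(opprK (a *+ m.+1)); exact: genN.
Qed.

End Words.

Lemma independent_card_eq (A : zmodType) : ~ countable [set: A] ->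
  exists2 X : set A, independent X & X #= [set: A].
Proof.
move=> Aunc; have [X indX essX] := maximal_independent A; exists X => //.
apply/card_eqPle; split; first exact: card_leT.
have X0 : X !=set0.
  apply: contrapT => /nonemptyPn X0; apply: Aunc.
  have -> : [set: A] = [set 0]; last exact: countable1.
  apply/seteqP; split=> // a _ /=; apply: contrapT => /eqP /essX[n /eqP an0].
  by rewrite X0 => /gen_set0.
have AX : [set: A] #<= [set: seq (X * nat)].
  apply: (@card_le_rel _ _ _ _ (fun a w => word_eval w = a)); last first.
    by move=> a b w _ _ <-.
  move=> a _.
  by have [w _ <-] := word_eval_surj essX X0 a; exists w.
(* For infinite [X] the words are no more numerous than [X]; for finite [X] they are countable,
   which contradicts the uncountability of [A]. *)
have [Xfin|Xinf] := EM (finite_set X); last first.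
  apply: card_le_trans AX _; rewrite -(card_le_eqr (card_setT X)).
  apply: infinite_card_seq_nat => /=; apply: contra_not Xinf.
  by rewrite (eq_finite_set (card_setT X)).
case: Aunc; apply: sub_countable AX _.
have : countable [set: X].
  by rewrite (eq_countable (card_setT X)); exact: finite_set_countable.
by move: (X : Type) => T /Pcountable[T' ->]; exact: countableP.
Qed.

(** * The Chabauty space *)

Lemma filter_bigcap_finite (I T : Type) (N : set_system T) (F : set I)
    (P : I -> set T) : Filter N -> finite_set F ->
  (forall i, F i -> N (P i)) -> N (\bigcap_(i in F) P i).
Proof.
elim/Pchoice: I F P => I F P NF /finite_fsetP[D ->] NP.
exact: filter_bigI.
Qed.

(** The sets containing a finite cylinder around [f] form a filter that converges to [f] in every
    coordinate, hence in the product. Conversely, a cylinder is a finite intersection of coordinate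
    neighbourhoods. *)
Lemma nbhs_cubeP (I : Type) (f : cube I) (U : set (cube I)) :
  nbhs f U <-> exists2 F : set I, finite_set F &
    [set g : cube I | forall i, F i -> g i = f i] `<=` U.
Proof.
pose N : set_system (cube I) := [set U | exists2 F : set I, finite_set F &
    [set g : cube I | forall i, F i -> g i = f i] `<=` U].
have NF : Filter N.
  split.
  - by exists set0.
  - move=> V W [F finF FV] [G finG GW]; exists (F `|` G).
      by rewrite finite_setU.
    by move=> g gE; split; [apply: FV|apply: GW] => i ?; apply: gE; [left|right].
  - by move=> V W VW [F finF FV]; exists F => // g /FV/VW.
split.
  suff Nf : N --> f by exact: Nf.
  apply/cvg_sup => i V [_ [[W Wo <-] Wf] WV].
  exists [set i]; first exact: finite_set1.
  by move=> g gE; apply: WV; rewrite /= gE.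
move=> [F finF FU]; apply: filterS FU _.
have : nbhs f (\bigcap_(i in F) [set g : cube I | g i = f i]).
  apply: filter_bigcap_finite => // i _.
  have /cvg_sup/(_ i)/= : nbhs f --> f by exact: cvg_id.
  apply; exists [set g : cube I | g i = f i]; split=> //.
  by exists [set f i] => //; exact: discrete_open.
by apply: filterS.
Qed.

Lemma nbhs_set_typeP (T : topologicalType) (D : set T) (x : D) (U : set D) :
  nbhs x U <-> exists2 V, nbhs (val x) V & val @^-1` V `<=` U.
Proof.
split=> [[_ [[V Vo <-] Vx] VU]|[V Vx VU]].
  by exists V => //; apply: open_nbhs_nbhs.
apply: filterS VU _; exact: (@initial_continuous _ _ val).
Qed.

Section Chabauty.
Variable A : zmodType.
Implicit Types (S T : chabauty A) (a x : A) (X : set A).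

Definition chab_mem S a : bool := (set_val S : cube A) a.

Lemma nbhs_chabautyP S (U : set (chabauty A)) :
  nbhs S U <-> exists2 F : set A, finite_set F &
    [set T | forall a, F a -> chab_mem T a = chab_mem S a] `<=` U.
Proof.
split=> [/nbhs_set_typeP[V /nbhs_cubeP[F finF FV] VU]|[F finF FU]].
  by exists F => // T TS; exact/VU/FV.
apply/nbhs_set_typeP.
exists [set g : cube A | forall a, F a -> g a = chab_mem S a] => //.
by apply/nbhs_cubeP; exists F.
Qed.

Definition gen_chab X : chabauty A := SigSub (mem_set (gen_zmod_closed X) :
  (fun a => `[< gen X a >]) \in [set S : cube A | zmod_closed (S : {pred A})]).

Lemma mem_gen_chab X a : chab_mem (gen_chab X) a = `[< gen X a >].
Proof. by []. Qed.

(** * Neighbourhoods of the trivial subgroup *)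

Definition avoiding a : set (chabauty A) := [set S | ~~ chab_mem S a].

Lemma nbhs_avoiding a : a != 0 -> nbhs (gen_chab set0) (avoiding a).
Proof.
move=> a0; apply/nbhs_chabautyP; exists [set a]; first exact: finite_set1.
move=> S /(_ a erefl); rewrite /avoiding /= => ->; rewrite mem_gen_chab.
by apply: contra a0 => /asboolP/gen_set0 ->.
Qed.

(** A neighbourhood [b] constrains membership of finitely many elements only, and each nonzero one
    lies in <x> for at most one [x] in [X]. For every other [x], the subgroup <x> belongs to [b] and
    contains [x]. *)
Lemma finite_nbhs_avoiding X (b : set (chabauty A)) : independent X ->
  nbhs (gen_chab set0) b -> finite_set [set x | X x /\ b `<=` avoiding x].
Proof.
move=> indX /nbhs_chabautyP[F finF Fb].
pose Z a := [set x | [/\ X x, a != 0 & gen [set x] a]].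
have Zfin a : finite_set (Z a).
  have [[x [Xx a0 xa]]|Z0] := EM (Z a !=set0); last first.
    by rewrite (_ : Z a = set0) //; exact/nonemptyPn.
  apply: sub_finite_set (finite_set1 x) => y [Xy _ ya].
  exact: independent_gen1_inj indX Xy Xx a0 ya xa.
apply: sub_finite_set (bigcup_finite finF (fun a _ => Zfin a)) => x [Xx bx].
apply: contrapT => nFx; have : avoiding x (gen_chab [set x]).
  apply/bx/Fb => a Fa; rewrite !mem_gen_chab; apply/asboolP/asboolP; last first.
    by move/gen_set0 ->; exact: gen0.
  move=> xa; suff -> : a = 0 by exact: gen0.
  by apply: contrapT => /eqP a0; apply: nFx; exists a.
by rewrite /avoiding /= mem_gen_chab => /negP; apply; apply/asboolP; exact: gen_in.
Qed.

(** * Embedding of the cube *)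

Section Embedding.
Variables (I : Type) (X : set A) (e : I -> A).
Hypotheses (indX : independent X) (eX : forall i, X (e i)) (einj : injective e).

Definition cube_chab (J : cube I) : chabauty A := gen_chab (e @` [set i | J i]).

Lemma mem_cube_chab J i : chab_mem (cube_chab J) (e i) = J i.
Proof.
rewrite mem_gen_chab; apply/asboolP/idP => [|Ji]; last by apply: gen_in; exists i.
move=> Ji; have JX : e @` [set i | J i] `<=` X by move=> _ [j _ <-].
by have [j Jj /einj <-] := independent_gen_inj indX JX (eX i) Ji.
Qed.

(** If [a] lies in the subgroup generated by a finite part [s] of [range e], then it lies in <J>
    exactly when it lies in the subgroup generated by the part of [J] in [s]. If no such [s] exists,
    [a] lies in no <J>. *)
Lemma cube_chab_local a : exists2 F : set I, finite_set F &
  forall J K : cube I, (forall i, F i -> J i = K i) ->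
    chab_mem (cube_chab J) a = chab_mem (cube_chab K) a.
Proof.
have eJX (J : set I) : e @` J `<=` X by move=> _ [i _ <-].
have [/gen_finite[s sX sa]|na] := EM (gen (range e) a); last first.
  exists set0 => // J K _; rewrite !mem_gen_chab.
  by apply/asboolP/asboolP => ga; case: na; apply: genS ga; exact: image_subset.
exists (e @^-1` [set` s]).
  by apply: finite_preimage; [move=> i j _ _ /einj|exact: finite_seq].
have imp J K : (forall i, e i \in s -> J i = K i) ->
    gen (e @` [set i | J i]) a -> gen (e @` [set i | K i]) a.
  move=> JK Ja.
  have : gen (e @` [set i | J i] `&` [set` s]) a.
    apply: (independent_gen_setI indX) => // x /sX/set_mem; exact: eJX.
  by apply: genS => _ [[i Ji <-] si]; exists i => //=; rewrite -JK.
move=> J K JK; rewrite !mem_gen_chab.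
by apply/asboolP/asboolP; apply: imp => i si; rewrite JK.
Qed.

Lemma cube_chab_continuous : continuous cube_chab.
Proof.
move=> J U /nbhs_chabautyP[F finF FU].
have /choice[G GP] : forall a, exists G : set I, finite_set G /\
    forall J K : cube I, (forall i, G i -> J i = K i) ->
    chab_mem (cube_chab J) a = chab_mem (cube_chab K) a.
  by move=> a; have [G] := cube_chab_local a; exists G.
apply/nbhs_cubeP; exists (\bigcup_(a in F) G a).
  by apply: bigcup_finite => // a _; exact: (GP a).1.
move=> K KJ; apply: FU => a Fa; apply: (GP a).2 => i Gi.
by apply: KJ; exists a.
Qed.

Lemma homeomorphic_cube :
  exists Y : set (chabauty A), homeomorphic (set_type Y) (cube I).
Proof.
exists (range cube_chab).
(* The inverse reads off membership of the generators, so each of its coordinates depends on a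
   single element of [A]. *)
pose f (S : range cube_chab) : cube I := fun i => chab_mem (set_val S) (e i).
pose g (J : cube I) : range cube_chab := SigSub (mem_set (imageT cube_chab J)).
have gK : cancel g f by move=> J; apply/funext => i; exact: mem_cube_chab.
exists f, g; split=> //.
- move=> S; apply/val_inj; have [J _ JS] := set_valP S.
  rewrite -[RHS]JS /=; congr cube_chab; rewrite -[RHS]gK.
  by congr f; apply/val_inj; rewrite /= JS.
- move=> S U /nbhs_cubeP[F finF FU].
  apply/nbhs_set_typeP; exists [set T | forall a, (e @` F) a ->
      chab_mem T a = chab_mem (set_val S) a].
    by apply/nbhs_chabautyP; exists (e @` F) => //; exact: finite_image.
  by move=> T TS; apply: FU => i Fi; apply: TS; exists i.
- move=> J U /nbhs_set_typeP[V JV VU].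
  apply: (@filterS _ (nbhs J) _ _ _ _ (cube_chab_continuous JV)) => K KV.
  exact: (VU (g K)).
Qed.

End Embedding.

(** * Size of bases and failure of metrizability *)

Lemma basis_card_ge X (B : set (set (chabauty A))) : ~ countable X ->
  independent X -> basis B -> X #<= B.
Proof.
move=> Xunc indX [Bo Bnbhs].
(* Relate [x] to the basic neighbourhoods of the trivial subgroup inside [avoiding x]; each basic
   set serves only finitely many [x]. *)
apply: (@card_le_fibers _ _ _ _
  (fun x b => b (gen_chab set0) /\ b `<=` avoiding x)) => // [x Xx|b Bb].
  have [x0 _] := indX x Xx; have [b [Bb b0] bx] := Bnbhs _ _ (nbhs_avoiding x0).
  by exists b.
have [b0|nb0] := EM (b (gen_chab set0)); last first.
  by apply: sub_countable (countable0 A); apply: subset_card_le => x [_ []].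
apply: finite_set_countable.
have /(finite_nbhs_avoiding indX) : nbhs (gen_chab set0) b.
  by apply: open_nbhs_nbhs; split=> //; exact: Bo.
by apply: sub_finite_set => x [Xx []].
Qed.

(** Label 0 demands membership, any other label non-membership. Labels are in [nat] so that
    [infinite_card_seq_nat] bounds the number of cylinders. *)
Definition cylinder (w : seq (A * nat)) : set (chabauty A) :=
  [set S | forall p, p \in w -> chab_mem S p.1 = (p.2 == 0%N)].

Lemma cylinder_basis : basis (range cylinder).
Proof.
split=> [_ [w _ <-]|S U /nbhs_chabautyP[F /finite_seqP[s ->] sU]].
  rewrite openE => S Sw; apply/nbhs_chabautyP.
  exists [set` [seq p.1 | p <- w]]; first exact: finite_seq.
  move=> T TS p pw; rewrite -Sw//; apply: TS; exact: map_f.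
exists (cylinder [seq (a, if chab_mem S a then 0%N else 1%N) | a <- s]).
  split; first by eexists.
  by move=> _ /mapP[a _ ->] /=; case: chab_mem.
move=> T TS; apply: sU => a sa.
by have /= -> := TS _ (map_f _ sa); case: chab_mem.
Qed.

(** Pulling back the balls of radius 1/(n+1) gives countably many neighbourhoods of the trivial
    subgroup. Each lies in [avoiding x] for finitely many [x], yet every [x] in [X] occurs for some
    [n], so [X] would be countable. *)
Lemma not_metrizable_chabauty (R : realType) X : ~ countable X ->
  independent X -> ~ metrizable R (chabauty A).
Proof.
move=> Xunc indX [M [f [g [fK gK fc gc]]]]; apply: Xunc.
pose b (n : nat) := f @^-1` ball (f (gen_chab set0)) (n.+1%:R^-1 : R).
have b0 n : nbhs (gen_chab set0) (b n).
  by apply: fc; apply: nbhsx_ballx; rewrite invr_gt0.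
have : countable (\bigcup_n [set x | X x /\ b n `<=` avoiding x]).
  apply: bigcup_countable => // n _; apply: finite_set_countable.
  exact: finite_nbhs_avoiding.
apply: sub_countable; apply: subset_card_le => x Xx.
have [x0 _] := indX x Xx; have := nbhs_avoiding x0.
rewrite -{1}(fK (gen_chab set0)) => /gc/nbhs_ballP[r r0 rx].
have [n nr] : exists n, n.+1%:R^-1 < r.
  have [N _ /(_ N (leqnn N))] := near_infty_natSinv_lt (PosNum r0).
  by exists N.
exists n => //; split=> // S bS; rewrite -(fK S); apply: rx.
exact: le_ball (ltW nr) _ bS.
Qed.

End Chabauty.

Theorem propositionB (R : realType) (A : zmodType) :
  (forall alpha : Type,
     [set: A] #= [set: alpha] -> ~ countable [set: alpha] ->
     (exists X : set (chabauty A), homeomorphic (set_type X) (cube alpha)) /\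
     least_basis_card alpha (chabauty A)) /\
  (~ countable [set: A] -> ~ metrizable R (chabauty A)).
Proof.
split=> [alpha Aalpha alphaunc|Aunc]; last first.
  have [X indX XA] := independent_card_eq Aunc.
  by apply: not_metrizable_chabauty indX; rewrite (eq_countable XA).
have Aunc : ~ countable [set: A] by rewrite (eq_countable Aalpha).
have [X indX XA] := independent_card_eq Aunc.
have Xunc : ~ countable X by rewrite (eq_countable XA).
have alphaX : [set: alpha] #= X.
  by rewrite card_eq_sym; apply: card_eq_trans XA Aalpha.
have basis_ge (B : set (set (chabauty A))) : basis B -> [set: alpha] #<= B.
  by move=> bB; rewrite (card_le_eql alphaX); exact: basis_card_ge Xunc indX bB.
split.
  have alpha0 : [set: alpha] !=set0.
    apply: contrapT => /nonemptyPn alpha0; apply: alphaunc.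
    by rewrite alpha0; exact: countable0.
  have /card_eqPle[/(card_le_funP alpha0)[e eX einj] _] := alphaX.
  apply: (@homeomorphic_cube _ _ X e) => // [i|i j /einj]; first exact: eX.
  by apply; rewrite inE.
split=> //; exists (range (@cylinder A)); split; first exact: cylinder_basis.
(* The number of words bounds the cylinder basis from above; the bound valid for all bases gives the
   other inequality. *)
apply/card_eqPle; split; last exact/basis_ge/cylinder_basis.
apply: card_le_trans (card_image_le _ _) _; rewrite -(card_le_eqr Aalpha).
by apply: infinite_card_seq_nat => /finite_set_countable.
Qed.
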